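(* Let $F:\mathbb{R}^d\to\mathcal{CC}(\mathbb{R}^d)$ be upper semicontinuous and relaxed one-sided Lipschitz with constant $l<0$, and let $\tilde x\in\mathbb{R}^d$ and $\bar y\in\mathbb{R}^d$ be given. Then there exists a solution \[\bar x\in S_F(\bar y):=\{x\in\mathbb{R}^d:\ \bar y\in F(x)\}\] satisfying \[\Big|\bar x-\Big(\tilde x+\frac{1}{2l}\big(\bar y-\mathrm{Proj}(\bar y,F(\tilde x))\big)\Big)\Big|\le-\frac{1}{2l}\,\mathrm{dist}(\bar y,F(\tilde x)),\] and the set $S_F(\bar y)$ is closed. If $F$ is in addition $L$-Lipschitz, then for any $\bar x\in S_F(\bar y)$, \[|\bar x-\tilde x|\ge\frac{1}{L}\,\mathrm{dist}(\bar y,F(\tilde x)).\]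
   Context: $\mathbb{R}^d$ carries the Euclidean norm $|\cdot|$ and Euclidean inner product $\langle\cdot,\cdot\rangle$. $\mathcal{CC}(\mathbb{R}^d)$ is the family of nonempty compact convex subsets of $\mathbb{R}^d$. For $A,B\in\mathcal{CC}(\mathbb{R}^d)$, $\mathrm{dist}(A,B):=\sup_{a\in A}\inf_{b\in B}|a-b|$ (for a point $y$, $\mathrm{dist}(y,B):=\inf_{b\in B}|y-b|$) and $\mathrm{dist}_H(A,B):=\max\{\mathrm{dist}(A,B),\mathrm{dist}(B,A)\}$. For $y\in\mathbb{R}^d$ and $A\in\mathcal{CC}(\mathbb{R}^d)$, $\mathrm{Proj}(y,A)$ is the unique point of $A$ with $|y-\mathrm{Proj}(y,A)|=\mathrm{dist}(y,A)$. A map $F:\mathbb{R}^d\to\mathcal{CC}(\mathbb{R}^d)$ is: upper semicontinuous if for every $x\in\mathbb{R}^d$, $\mathrm{dist}(F(x'),F(x))\to0$ as $x'\to x$; $L$-Lipschitz, with $L\ge0$, if $\mathrm{dist}_H(F(x),F(x'))\le L|x-x'|$ for all $x,x'\in\mathbb{R}^d$; relaxed one-sided Lipschitz with constant $l\in\mathbb{R}$ ($l$-ROSL) if for any $x,x'\in\mathbb{R}^d$ and $y\in F(x)$ there exists $y'\in F(x')$ with $\langle y-y',x-x'\rangle\le l|x-x'|^2$. *)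

(* Defs.v *)
From HB Require Import structures.
From mathcomp Require Import all_boot all_order all_algebra.
From mathcomp Require Import all_classical all_reals all_analysis.

Set Implicit Arguments.
Unset Strict Implicit.
Unset Printing Implicit Defensive.

Import Order.TTheory GRing.Theory Num.Theory.
Import numFieldNormedType.Exports.

Local Open Scope classical_set_scope.
Local Open Scope ring_scope.

(* R^d is 'rV[R]_d.  The library norm `|_| on 'rV[R]_d is the sup norm, so the
   Euclidean one is introduced here; both induce the library topology, which
   is the one used for "compact", "closed" and limits. *)
Definition dotp (R : realType) (d : nat) (u v : 'rV[R]_d) : R :=
  \sum_(i < d) u 0 i * v 0 i.

Definition enorm (R : realType) (d : nat) (u : 'rV[R]_d) : R :=
  Num.sqrt (dotp u u).

Definition CC (R : realType) (d : nat) (A : set 'rV[R]_d) : Prop :=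
  [/\ A !=set0, compact A & convex_set A].

Definition dist_pt (R : realType) (d : nat) (y : 'rV[R]_d)
    (B : set 'rV[R]_d) : R :=
  inf [set enorm (y - b) | b in B].

(* inf and sup are total functions on sets of reals; they are the genuine
   infimum and supremum when the set is nonempty and bounded, as is the case
   here and in dist_pt for arguments satisfying CC. *)
Definition dist_set (R : realType) (d : nat) (A B : set 'rV[R]_d) : R :=
  sup [set dist_pt a B | a in A].

Definition dist_haus (R : realType) (d : nat) (A B : set 'rV[R]_d) : R :=
  Num.max (dist_set A B) (dist_set B A).

(* The default value 0 is irrelevant when CC A: there is then exactly one
   point of A at minimal distance from y. *)
Definition metric_proj (R : realType) (d : nat) (y : 'rV[R]_d)
    (A : set 'rV[R]_d) : 'rV[R]_d :=
  xget 0 [set p | A p /\ enorm (y - p) = dist_pt y A].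

Definition upper_semicontinuous (R : realType) (d : nat)
    (F : 'rV[R]_d -> set 'rV[R]_d) : Prop :=
  forall x : 'rV[R]_d, dist_set (F x') (F x) @[x' --> x] --> (0 : R).

Definition set_lipschitz (R : realType) (d : nat) (L : R)
    (F : 'rV[R]_d -> set 'rV[R]_d) : Prop :=
  forall x x' : 'rV[R]_d, dist_haus (F x) (F x') <= L * enorm (x - x').

Definition rosl (R : realType) (d : nat) (l : R)
    (F : 'rV[R]_d -> set 'rV[R]_d) : Prop :=
  forall x x' y : 'rV[R]_d, F x y ->
    exists2 y' : 'rV[R]_d, F x' y' &
      dotp (y - y') (x - x') <= l * enorm (x - x') ^+ 2.

Definition solutions (R : realType) (d : nat)
    (F : 'rV[R]_d -> set 'rV[R]_d) (y : 'rV[R]_d) : set 'rV[R]_d :=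
  [set x | F x y].

(* Main.v *)
Require Import Defs.
From HB Require Import structures.
From mathcomp Require Import all_boot all_order all_algebra all_fingroup.
From mathcomp Require Import all_classical all_reals all_analysis.
From mathcomp Require Import ring lra.

(** Write [z = x - xt] and let [p] be the projection of [yb] onto [F xt].
    Multiplying by [l < 0] shows that the ball of the theorem is the region [K]
    where [al x := l <z, z> + <p - yb, z>] is nonnegative.  Applied to the pair
    [(xt, p)], the relaxed one-sided Lipschitz condition says that every [F x]
    contains some [y] with [<y - yb, z> <= al x].  In particular [y - yb] points
    towards [xt] outside [K].  A solution in [K] is then forced by a topological
    argument ([exists_solution]): if there were none, the hyperplanes separating
    [yb] from [F x] for [x] in [K], which are stable in [x] by upper
    semicontinuity ([local_separation]), could be glued by a finite family of
    bump functions, together with the direction [xt - x] outside [K], into a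
    continuous vector field without zeros that points inwards on the boundary of
    a large cube.

    Such a field contradicts the Poincare-Miranda theorem ([poincare_miranda]).
    The latter follows by compactness from a combinatorial fact about grids
    ([bichromatic_cube]): if the bit [lam i] is [0] on one facet orthogonal to
    axis [i] and [1] on the other, some unit cube sees both values of every
    [lam i].  To see this, regard the labels as 0-cochains mod 2 on Kuhn's
    triangulation and sum the cup product of their coboundaries over all
    simplices.  By a discrete Stokes formula ([discrete_stokes]) the sum does
    not depend on the labels ([parity_eq]), and it is [1] for the simplest ones
    ([parity_odd]); a simplex with nonzero contribution lies in the required
    cube.

    The local separation also shows that the set of points that are not
    solutions is open.  The lower bound is the Lipschitz condition read at the
    point [yb] of [F xb]. *)

Import Order.TTheory GRing.Theory Num.Theory.
Import numFieldNormedType.Exports.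

Set Implicit Arguments.
Unset Strict Implicit.
Unset Printing Implicit Defensive.

(** * Simplicial cochains mod 2 *)

Section Cochains.
Variable V : eqType.
Implicit Types (f g : V -> bool) (Z : seq V -> bool) (w : seq V).

(** The cup product of the coboundary of the 0-cochain [f] with the cochain [Z],
    on simplices given as lists of vertices; bits are the integers mod 2, with
    [(+)] as sum and [&&] as product. *)
Definition dcup f Z w :=
  if w is u :: (v :: _) as t then (f u (+) f v) && Z t else false.

Definition cup (L : seq (V -> bool)) : seq V -> bool :=
  foldr dcup (fun=> true) L.

(** The sum of [Z] over the faces of a simplex: the first summand deletes the head
    vertex, the recursive call one of the others. *)
Fixpoint coboundary Z w : bool :=
  if w is u :: t then Z t (+) coboundary (fun t' => Z (u :: t')) t else false.

Lemma coboundary_andl b Z w : coboundary (fun t => b && Z t) w = b && coboundary Z w.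
Proof.
by elim: w Z => /= [|u w IH] Z; rewrite ?andbF // IH andb_addr.
Qed.

(** The Leibniz rule mod 2, where the term differentiating the first factor is
    absent because that factor is itself a coboundary. *)
Lemma coboundary_dcup f Z u v w :
  w != [::] -> coboundary (dcup f Z) (u :: v :: w) = (f u (+) f v) && coboundary Z (v :: w).
Proof.
case: w => // t w _ /=; rewrite !coboundary_andl.
by case: (f u); case: (f v); case: (f t); case: (Z (t :: w)); case: (Z (v :: w));
  case: (coboundary _ w).
Qed.

Lemma coboundary_foldr_dcup L Z w : (size L).+1 < size w ->
  coboundary (foldr dcup Z L) w = foldr dcup (coboundary Z) L w.
Proof.
elim: L w => [//|f L IH] [|u [|v [|t w]]] // sz.
by rewrite [foldr _ _ (f :: L)]/= coboundary_dcup // IH.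
Qed.

(** A product of coboundaries is closed; the vertex count makes the last factor
    of the Leibniz expansion the coboundary of a constant. *)
Lemma coboundary_cup L w : size w = (size L).+2 -> coboundary (cup L) w = false.
Proof.
elim: L w => [|f L IH] [|u [|v w]] //; first by case: w.
by case=> sz; rewrite [cup _]/= coboundary_dcup ?IH ?andbF // -?size_eq0 ?sz //= sz.
Qed.

(** The cochain [dL1 ... k ... dL2]: [k] itself stands where its coboundary would
    be, which makes it a primitive of [cup (L1 ++ k :: L2)]. *)
Definition primitive (L1 L2 : seq (V -> bool)) (k : V -> bool) : seq V -> bool :=
  foldr dcup (fun w => if w is u :: _ then k u && cup L2 w else false) L1.

Lemma coboundary_primitive L1 L2 k w : size w = (size L1 + size L2).+2 ->
  coboundary (primitive L1 L2 k) w = cup (L1 ++ k :: L2) w.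
Proof.
move=> sz; rewrite /primitive coboundary_foldr_dcup ?sz ?ltnS ?leq_addr //.
rewrite /cup foldr_cat; elim: L1 w sz => [|f L1 IH] [|u [|v w]] //=.
- case=> sz; rewrite coboundary_andl.
  have := @coboundary_cup L2 [:: u, v & w]; rewrite /= sz => /(_ erefl).
  by rewrite -/(cup L2); case: (k u); case: (k v); case: (cup _ _);
    case: (coboundary _ w); case: (cup L2 (u :: w)).
by case=> sz; rewrite IH //= sz addSn.
Qed.

Lemma cup_addb L1 L2 f g w :
  cup (L1 ++ f :: L2) w (+) cup (L1 ++ g :: L2) w =
  cup (L1 ++ (fun v => f v (+) g v) :: L2) w.
Proof.
elim: L1 w => [|h L1 IH] [|u [|v w]] //=; last by rewrite -IH andb_addr.
rewrite -/(cup _).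
by case: (cup _ _); case: (f u); case: (g u); case: (f v); case: (g v).
Qed.

Lemma dcup_const f Z w : {in w &, forall u v, f u = f v} -> dcup f Z w = false.
Proof.
case: w => // u [|v w] //= fc; rewrite (fc u v) ?addbb ?inE ?eqxx ?orbT //.
Qed.

Lemma foldr_dcup_const (I : eqType) (lam : I -> V -> bool) r i Z w : i \in r ->
  {in w &, forall u v, lam i u = lam i v} ->
  foldr dcup Z [seq lam j | j <- r] w = false.
Proof.
elim: r w => //= j r IH w; rewrite inE => /orP[/eqP<-|ir] lc.
  exact: dcup_const.
case: w lc => // u [|v w] //= lc; rewrite IH ?andbF // => x y xw yw.
by apply: lc; rewrite inE ?xw ?yw orbT.
Qed.

Lemma primitive_const (I : eqType) (lam : I -> V -> bool) r1 r2 k i w :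
  i \in r1 ++ r2 -> {in w &, forall u v, lam i u = lam i v} ->
  primitive [seq lam j | j <- r1] [seq lam j | j <- r2] k w = false.
Proof.
rewrite mem_cat; case: (boolP (i \in r1)) => [ir1 _|_ /= ir2].
  exact: foldr_dcup_const.
rewrite /primitive.
elim: r1 w => [|j r1 IH] [|u [|v w]] lc //=.
- by rewrite -/(cup _) /cup (foldr_dcup_const _ ir2) // andbF.
- by rewrite -/(cup _) /cup (foldr_dcup_const _ ir2) // andbF.
by rewrite IH ?andbF // => x y xw yw; apply: lc; rewrite inE ?xw ?yw orbT.
Qed.

Lemma primitive0 L1 L2 k w :
  {in w, forall u, k u = false} -> primitive L1 L2 k w = false.
Proof.
rewrite /primitive.
elim: L1 w => [|f L1 IH] [|u w] kw //=; first by rewrite kw ?mem_head.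
case: w kw => // v w kw; rewrite IH ?andbF // => x xw.
by apply: kw; rewrite inE xw orbT.
Qed.

Lemma cup_map_iota (lam : nat -> V -> bool) (pt : nat -> V) a m :
  cup [seq lam i | i <- iota a m] [seq pt j | j <- iota a m.+1] =
  all (fun i => lam i (pt i) (+) lam i (pt i.+1)) (iota a m).
Proof.
elim: m a => //= m IH a; rewrite -/(cup _) /=; congr (_ && _).
exact: IH a.+1.
Qed.

Lemma coboundary_map (pt : nat -> V) Z r : uniq r ->
  coboundary Z [seq pt j | j <- r] = \big[addb/false]_(k <- r) Z [seq pt j | j <- rem k r].
Proof.
elim: r Z => [|a r IH] Z /=; first by rewrite big_nil.
case/andP=> ar ur; rewrite big_cons eqxx IH //; congr (_ (+) _).
rewrite big_seq [RHS]big_seq; apply: eq_bigr => k kr.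
by case: eqP => // ak; rewrite ak kr in ar.
Qed.

End Cochains.

(** Right multiplication by an odd permutation exchanges even and odd
    permutations, so the terms cancel in pairs mod 2. *)
Lemma addb_sum_involution (n : nat) (F : 'S_n -> bool) (t : 'S_n) :
  odd_perm t -> (forall s, F (s * t)%g = F s) ->
  \big[addb/false]_(s : 'S_n) F s = false.
Proof.
move=> ot Ft; rewrite (bigID (@odd_perm _)) /=.
rewrite (reindex_inj (mulIg t)) /=.
rewrite (eq_big (fun s => ~~ odd_perm s) F); first exact: addbb.
  by move=> s; rewrite odd_permM ot addbT.
by move=> s _; rewrite Ft.
Qed.

(** * The parity of a labelling of the grid *)

Section Kuhn.
Variables (n q : nat).
Local Notation N := n.+1.
Local Notation p := q.+1.
Local Notation V := {ffun 'I_N -> nat}.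
Implicit Types (c : {ffun 'I_N -> 'I_p}) (s : 'S_N).

(** Kuhn's triangulation of the grid [0, p]^N: the simplices of the cube with
    lowest corner [c] climb to its highest corner along the axes one at a time,
    and [s i] is the time at which coordinate [i] is increased. *)
Definition kuhn_vertex c s (j : nat) : V := [ffun i => c i + (s i < j)].
Definition kuhn_chain c s : seq V := [seq kuhn_vertex c s j | j <- iota 0 N.+1].

(** Deleting an intermediate vertex [k] forgets the order of the two steps around
    it, so the face is shared with the simplex where these steps are exchanged. *)
Lemma inner_faces_cancel (Z : seq V -> bool) c (k : nat) : 0 < k < N ->
  \big[addb/false]_(s : 'S_N) Z [seq kuhn_vertex c s j | j <- rem k (iota 0 N.+1)] = false.
Proof.
case: k => // k; rewrite ltnS => /andP[_ kn].
pose a : 'I_N := inord k; pose b : 'I_N := inord k.+1.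
have ea : a = k :> nat by rewrite inordK // ltnW.
have eb : b = k.+1 :> nat by rewrite inordK.
apply: (@addb_sum_involution _ _ (tperm a b)).
  by rewrite odd_tperm -val_eqE /= ea eb neq_ltn ltnSn.
move=> s; congr (Z _); apply/eq_in_map => j.
rewrite mem_rem_uniq ?iota_uniq // inE => /andP[jk _].
apply/ffunP=> i; rewrite !ffunE permM; congr (_ + nat_of_bool _).
have kj : (k < j) = (k.+1 < j) by rewrite leq_eqVlt eq_sym (negPf jk).
by case: tpermP => [->|->|//]; rewrite ea eb kj.
Qed.

Definition next_corner c s : {ffun 'I_N -> 'I_p} :=
  [ffun i => if s i == ord0 then ordS (c i) else c i].
(** The simplex across the face opposite to the lowest vertex: its cube is shifted
    along the first axis climbed by the old simplex, and that axis becomes the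
    last one climbed.  The shift is cyclic, so this is a bijection of all
    simplices even though a simplex on the far boundary has no neighbour. *)
Definition next_simplex (x : {ffun 'I_N -> 'I_p} * 'S_N) :=
  (next_corner x.1 x.2, (x.2 * perm (@ord_pred_inj N))%g).

Lemma next_simplex_inj : injective next_simplex.
Proof.
move=> [c s] [c' s'] [] /ffunP ec /mulIg es; subst s'.
congr (_, _); apply/ffunP => i; move: (ec i); rewrite !ffunE.
by case: ifP => // _ /ordS_inj.
Qed.

Definition on_boundary (w : seq V) :=
  exists i : 'I_N, {in w, forall v : V, v i = 0} \/ {in w, forall v : V, v i = p}.

(** Where the cyclic shift wraps around, both faces lie in the boundary, and [Z]
    vanishes on them. *)
Lemma outer_faces_match (Z : seq V -> bool) :
  (forall w, on_boundary w -> Z w = false) -> forall x,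
  Z [seq kuhn_vertex x.1 x.2 j | j <- iota 1 N] =
  Z [seq kuhn_vertex (next_simplex x).1 (next_simplex x).2 j | j <- iota 0 N].
Proof.
move=> Z0 [c s].
change (Z [seq kuhn_vertex c s j | j <- iota 1 N] =
  Z [seq kuhn_vertex (next_corner c s) (s * perm (@ord_pred_inj N))%g j | j <- iota 0 N]).
pose a := (s^-1)%g ord0.
have sa : s a = ord0 by rewrite permKV.
have sPa i : i != a -> s i != ord0.
  by apply: contraNneq => si; rewrite /a -si permK.
have predE i : i != a -> ord_pred (s i) = (s i).-1 :> nat.
  move=> /sPa; rewrite -val_eqE /= => si.
  rewrite -[in LHS](@prednK (s i)) ?lt0n // addSn /= modnDr modn_small //.
  by rewrite (leq_ltn_trans (leq_pred _)).
have pred0E : ord_pred (s a) = n :> nat by rewrite sa /= modn_small.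
have [ca|ca] := ltnP (c a).+1 p.
  congr (Z _); rewrite -[1]addn0 iotaDl -map_comp; apply/eq_in_map => j.
  rewrite mem_iota add0n => /andP[_ jN].
  apply/ffunP => i; rewrite !ffunE permM permE.
  have [->|ia] := eqVneq i a.
    by rewrite pred0E sa eqxx /= modn_small // ltnNge -ltnS jN addn0 addn1.
  rewrite (negPf (sPa i ia)) predE //; congr (_ + nat_of_bool _).
  by rewrite add1n ltnS -ltnS prednK // lt0n; apply: sPa.
rewrite !Z0 //.
  exists a; left => v /mapP[j]; rewrite mem_iota add0n => /andP[_ jN] ->.
  rewrite !ffunE permM permE pred0E sa eqxx /=.
  have /eqP -> : (c a).+1 == p by rewrite eqn_leq ca ltn_ord.
  by rewrite modnn ltnNge -ltnS jN.
exists a; right => v /mapP[j]; rewrite mem_iota => /andP[j0 jN] ->.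
by rewrite !ffunE sa j0 addn1; apply/eqP; rewrite eqn_leq ca ltn_ord.
Qed.

(** Every inner face belongs to two simplices, so that only boundary faces survive
    in the sum mod 2. *)
Lemma discrete_stokes (Z : seq V -> bool) :
  (forall w, on_boundary w -> Z w = false) ->
  \big[addb/false]_(x : {ffun 'I_N -> 'I_p} * 'S_N) coboundary Z (kuhn_chain x.1 x.2) = false.
Proof.
move=> Z0.
under eq_bigr do rewrite coboundary_map ?iota_uniq //.
pose G k := \big[addb/false]_(x : {ffun 'I_N -> 'I_p} * 'S_N)
  Z [seq kuhn_vertex x.1 x.2 j | j <- rem k (iota 0 N.+1)].
rewrite exchange_big (eq_bigr G) //.
have iotaE : iota 0 N.+1 = 0 :: iota 1 n ++ [:: N].
  by rewrite -[N.+1]addn1 iotaD add0n.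
rewrite iotaE big_cons big_cat big_seq1 big_seq big1 => [|k].
  change (G 0 (+) G N = false).
  rewrite [X in _ (+) X](reindex_inj next_simplex_inj) /G -big_split big1 // => x _.
  have -> : rem 0 (iota 0 N.+1) = iota 1 N by [].
  have -> : rem N (iota 0 N.+1) = iota 0 N.
    have /all_filterP <- : all (predC1 N) (iota 0 N).
      by apply/allP => j; rewrite mem_iota => /ltn_eqF /negbT.
    rewrite rem_filter ?iota_uniq // -[N.+1]addn1 iotaD filter_cat.
    by rewrite [X in _ ++ X]/= eqxx cats0.
  by rewrite outer_faces_match //= addbb.
rewrite mem_iota add1n => kn; rewrite /G.
rewrite -(pair_big xpredT xpredT (fun c s =>
    Z [seq kuhn_vertex c s j | j <- rem k (iota 0 N.+1)])) /=.
by rewrite big1 // => c _; apply: inner_faces_cancel.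
Qed.

(** Label [i] tells apart the two facets of the grid orthogonal to axis [i]. *)
Definition admissible (lam : nat -> V -> bool) := forall (i : 'I_N) (v : V),
  (v i = 0 -> lam i v = false) /\ (v i = p -> lam i v = true).

(** A discrete degree mod 2: the integral over the grid of the product of the
    coboundaries of the labels. *)
Definition parity (lam : nat -> V -> bool) : bool :=
  \big[addb/false]_(x : {ffun 'I_N -> 'I_p} * 'S_N)
    cup [seq lam i | i <- iota 0 N] (kuhn_chain x.1 x.2).

(** Two admissible choices of label [t] differ by a [k] vanishing on the facets
    orthogonal to axis [t]; on any other facet some label [i] is constant.  Hence
    the primitive of the difference vanishes on the boundary. *)
Lemma parity_change_one lam lam' (t : 'I_N) : admissible lam -> admissible lam' ->
  (forall i : nat, i != t -> lam i = lam' i) -> parity lam = parity lam'.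
Proof.
move=> adm adm' eql.
suff : parity lam (+) parity lam' = false by case: (parity _); case: (parity _).
pose r2 := iota t.+1 (n - t).
have Ir : iota 0 N = iota 0 t ++ (t : nat) :: r2.
  rewrite -[in LHS](subnKC (ltn_ord t)) addSnnS iotaD add0n /=.
  by rewrite subSS.
pose k v := lam t v (+) lam' t v.
pose Z := primitive [seq lam i | i <- iota 0 t] [seq lam i | i <- r2] k.
rewrite /parity -big_split -[RHS](@discrete_stokes Z) => [|w [i bw]].
  apply: eq_bigr => x _; rewrite /Z coboundary_primitive; last first.
    rewrite !size_map !size_iota; congr _.+2.
    by rewrite subnKC // -ltnS ltn_ord.
  rewrite Ir !map_cat /= -/k.
  have eqm r : (t : nat) \notin r -> [seq lam' i | i <- r] = [seq lam i | i <- r].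
    by move=> tr; apply/eq_in_map => j jr; rewrite eql //; apply: contraNneq tr => <-.
  by rewrite !eqm ?mem_iota ?ltnn ?add0n ?ltnn //; exact: cup_addb.
have [eti|ti] := eqVneq i t.
  apply: primitive0 => v vw; rewrite /k -eti.
  have [a0 a1] := adm i v; have [b0 b1] := adm' i v.
  by case: bw => /(_ v vw) vi; [rewrite a0 ?b0 | rewrite a1 ?b1].
apply: (@primitive_const _ _ lam _ _ _ i) => [|u v uw vw].
  have : (i : nat) \in iota 0 N by rewrite mem_iota ltn_ord.
  by rewrite Ir !mem_cat inE val_eqE (negPf ti).
have [a0 a1] := adm i u; have [b0 b1] := adm i v.
by case: bw => bw; have := bw u uw; have := bw v vw => vi ui;
  [rewrite a0 ?b0 | rewrite a1 ?b1].
Qed.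

Lemma parity_eq lam lam' : admissible lam -> admissible lam' -> parity lam = parity lam'.
Proof.
move=> adm adm'; pose st t i := if i < t then lam' i else lam i.
have admst t : admissible (st t).
  by move=> i v; rewrite /st; case: ifP => _; [exact: adm' | exact: adm].
have tst t : t <= N -> parity (st t) = parity lam.
  elim: t => [_|t IH tN]; first by apply: eq_bigr.
  rewrite -IH 1?ltnW //; apply: (@parity_change_one _ _ (Ordinal tN)) => // i.
  by rewrite /st ltnS [i <= t]leq_eqVlt => /negPf ->.
rewrite -(tst N) //; apply: eq_bigr => x _; congr (cup _ _).
by apply/eq_in_map => i; rewrite mem_iota add0n /st => /andP[_ ->].
Qed.

(** The parity does not depend on the labels, and for the labels [0 < v i] the
    single simplex at the origin that climbs the axes in increasing order
    contributes. *)
Lemma parity_odd lam : admissible lam -> parity lam.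
Proof.
move=> adm; pose mu i (v : V) := 0 < v (inord i).
rewrite (@parity_eq lam mu) //; last first.
  by move=> i v; rewrite /mu inord_val; split=> ->.
rewrite /parity (bigD1 ([ffun=> ord0], 1%g)) // big1 => [|[c s]].
  rewrite [X in is_true X]addbF /kuhn_chain cup_map_iota; apply/allP => i; rewrite mem_iota add0n => iN.
  by rewrite /mu !ffunE perm1 inordK // ltnn ltnSn.
rewrite andTb; apply: contraNF; rewrite /kuhn_chain cup_map_iota => /allP cs.
have {}cs (i : 'I_N) : (c i == ord0) && (s i == i).
  have := cs i; rewrite mem_iota => /(_ (ltn_ord i)); rewrite /mu inord_val !ffunE ltnS.
  rewrite -!val_eqE /= !addn_gt0 !lt0b.
  by case: (c i : nat) => //=; case: ltngtP.
rewrite xpair_eqE; apply/andP; split.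
  by apply/eqP/ffunP => i; rewrite ffunE; case/andP: (cs i) => /eqP.
by apply/eqP/permP => i; rewrite perm1; case/andP: (cs i) => _ /eqP.
Qed.

(** In a nonzero term of the odd sum, label [i] changes along the [i]-th edge of
    the simplex. *)
Lemma bichromatic_cube lam : admissible lam ->
  exists c s, forall i : 'I_N, lam i (kuhn_vertex c s i) != lam i (kuhn_vertex c s i.+1).
Proof.
move=> /parity_odd; rewrite /parity => tot.
have [x /allP cx] : exists x : {ffun 'I_N -> 'I_p} * 'S_N,
    all (fun i => lam i (kuhn_vertex x.1 x.2 i) (+) lam i (kuhn_vertex x.1 x.2 i.+1)) (iota 0 N).
  apply/existsP; apply: contraTT tot => /existsPn no.
  by rewrite big1 // => x _; rewrite /kuhn_chain cup_map_iota; apply/negbTE/no.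
exists x.1, x.2 => i; have := cx i; rewrite mem_iota => /(_ (ltn_ord i)).
by case: (lam i _); case: (lam i _).
Qed.

End Kuhn.

Local Open Scope classical_set_scope.
Local Open Scope ring_scope.

(** * The Poincare-Miranda theorem *)

Definition cube (R : realType) n (a : 'rV[R]_n) (r : R) : set 'rV[R]_n :=
  [set x | forall i, `|x 0 i - a 0 i| <= r].

Lemma cube_compact (R : realType) n (a : 'rV[R]_n) (r : R) : compact (cube a r).
Proof.
have -> : cube a r = [set x | forall i, [set` `[a 0 i - r, a 0 i + r]] (x ord0 i)].
  by apply/seteqP; split=> x /= cx i; have := cx i; rewrite ler_distl in_itv.
by apply: (rV_compact (A := fun i => [set` `[a 0 i - r, a 0 i + r]])) => i; apply: segment_compact.
Qed.

Section PoincareMiranda.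
Variables (R : realType) (n : nat) (g : 'rV[R]_n -> 'rV[R]_n) (a : 'rV[R]_n) (r : R).
Hypothesis r0 : 0 < r.
Hypothesis g_left : forall x i, cube a r x -> x 0 i = a 0 i - r -> 0 <= g x 0 i.
Hypothesis g_right : forall x i, cube a r x -> x 0 i = a 0 i + r -> g x 0 i <= 0.

(** Label [i] of a grid point records whether [g _ i] is nonpositive, corrected on
    the facets where [g _ i] may vanish; the boundary conditions make the corrected
    labels truthful. *)
Lemma grid_sign_change (q : nat) : exists2 x, cube a r x &
  forall i, exists u w, [/\ cube a r u, cube a r w,
    (forall j, `|x 0 j - u 0 j| <= 2 * r / q.+1%:R) /\
    (forall j, `|x 0 j - w 0 j| <= 2 * r / q.+1%:R),
    g u 0 i <= 0 & 0 <= g w 0 i].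
Proof.
case: n g a g_left g_right => [|m] g' a' gl gr.
  by exists a' => [[]//|[]].
set h := 2 * r / q.+1%:R.
have h0 : 0 <= h by rewrite divr_ge0 // mulr_ge0 // ltW.
have hq : h * q.+1%:R = 2 * r by rewrite divfK.
pose pt (v : {ffun 'I_m.+1 -> nat}) : 'rV[R]_m.+1 :=
  \row_i (a' 0 i - r + (v i)%:R * h).
have ptcube (v : {ffun 'I_m.+1 -> nat}) : (forall i, v i <= q.+1)%N -> cube a' r (pt v).
  move=> vq i; rewrite mxE ler_distl.
  have : (v i)%:R * h <= 2 * r by rewrite -hq mulrC ler_wpM2l // ler_nat.
  have : 0 <= (v i)%:R * h by rewrite mulr_ge0.
  by move=> ? ?; apply/andP; split; lra.
pose lam (i : nat) (v : {ffun 'I_m.+1 -> nat}) : bool :=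
  (v (inord i) != 0%N) && ((v (inord i) == q.+1) || (g' (pt v) 0 (inord i) <= 0)).
have [|c [s cs]] := @bichromatic_cube m q lam.
  by move=> i v; rewrite /lam inord_val; split=> ->; rewrite ?eqxx.
have vq j i : (kuhn_vertex c s j i <= q.+1)%N.
  by rewrite ffunE; case: (_ < _)%N; rewrite ?addn1 ?addn0 // ltnW.
have near k l i : `|pt (kuhn_vertex c s k) 0 i - pt (kuhn_vertex c s l) 0 i| <= h.
  rewrite !mxE !ffunE !natrD !mulrDl.
  case: (_ < _)%N; case: (_ < _)%N; rewrite ?mul0r ?mul1r;
    by rewrite ler_distl; apply/andP; split; lra.
exists (pt (kuhn_vertex c s 0)) => [|i]; first exact/ptcube/vq.
have neg (v : {ffun 'I_m.+1 -> nat}) : (forall i, v i <= q.+1)%N -> lam i v -> g' (pt v) 0 i <= 0.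
  move=> vb; rewrite /lam inord_val => /andP[_ /orP[/eqP vi|//]].
  by apply: gr; [exact: ptcube | rewrite mxE vi mulrC hq; lra].
have pos (v : {ffun 'I_m.+1 -> nat}) : (forall i, v i <= q.+1)%N -> ~~ lam i v -> 0 <= g' (pt v) 0 i.
  move=> vb; rewrite /lam inord_val negb_and negbK => /orP[/eqP vi|].
    by apply: gl; [exact: ptcube | rewrite mxE vi mul0r addr0].
  by rewrite negb_or -ltNge => /andP[_ /ltW].
move: (cs i); case lu : (lam i (kuhn_vertex c s i)); case lw : (lam i (kuhn_vertex c s i.+1)) => // _.
  exists (pt (kuhn_vertex c s i)), (pt (kuhn_vertex c s i.+1)); split; try exact/ptcube/vq.
  - by split=> j; apply: near.
  - exact: (neg _ (vq _)).
  - by apply: (pos _ (vq _)); rewrite lw.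
exists (pt (kuhn_vertex c s i.+1)), (pt (kuhn_vertex c s i)); split; try exact/ptcube/vq.
- by split=> j; apply: near.
- exact: (neg _ (vq _)).
- by apply: (pos _ (vq _)); rewrite lu.
Qed.

Hypothesis g_cont : forall i, continuous (fun x => g x 0 i).

(** The zero is a cluster point of cubes of vanishing size on which each coordinate
    of [g] takes both signs. *)
Lemma poincare_miranda : exists2 x, cube a r x & g x = 0.
Proof.
pose sign_change x e i := exists u w,
  [/\ ball x e u, ball x e w, g u 0 i <= 0 & 0 <= g w 0 i].
pose P (q : nat) x := cube a r x /\
  forall e : R, 2 * r / q.+1%:R < e -> forall i, sign_change x e i.
have /choice[X XP] (q : nat) : exists x, P q x.
  have [x cx xP] := grid_sign_change q; exists x; split => // e qe i.
  have [u [w [_ _ [xu xw] gu gw]]] := xP i.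
  have e0 : 0 < e by apply: le_lt_trans qe; rewrite divr_ge0 // mulr_ge0 // ltW.
  exists u, w; split => //; split => // k j; rewrite ord1 /ball /=;
    exact: le_lt_trans qe.
have [x [ax clx]] : cube a r `&` cluster (X @ \oo) !=set0.
  apply: (@cube_compact _ _ a r (X @ \oo)).
  by exists 0%N => // q _; case: (XP q).
exists x => //; apply/rowP => i; rewrite mxE.
have meet e : 0 < e -> sign_change x e i.
  move=> e0; have e20 : 0 < e / 2 by rewrite divr_gt0.
  have : \forall q \near \oo, [set X q | q in [set q | 2 * r / q.+1%:R < e / 2]] (X q).
    near=> q; exists q => //=.
    rewrite ltr_pdivrMr // [ltRHS]mulrC -ltr_pdivrMr //.
    apply: (@lt_trans _ _ q%:R); last by rewrite ltr_nat.
    by near: q; exact: nbhs_infty_gtr.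
  move=> /clx /(_ (nbhsx_ballx x _ e20)) [_ [[q /= qe <-] xq]].
  have [_ /(_ _ qe i) [u [w [qu qw gu gw]]]] := XP q.
  exists u, w; split=> //; rewrite [e]splitr; apply: ball_triangle; eassumption.
apply/eqP; rewrite eq_le !leNgt; apply/andP; split; apply/negP => gx.
  have /nbhs_ballP[e /= e0 xe] : nbhs x [set y | 0 < g y 0 i].
    by have /cvgr_gt/(_ _ gx) := @g_cont i x.
  by have [u [w [/xe /= xu _ gu _]]] := meet e e0; rewrite ltNge gu in xu.
have /nbhs_ballP[e /= e0 xe] : nbhs x [set y | g y 0 i < 0].
  by have /cvgr_lt/(_ _ gx) := @g_cont i x.
by have [u [w [_ /xe /= xw _ gw]]] := meet e e0; rewrite ltNge gw in xw.
Unshelve. all: by end_near.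
Qed.

End PoincareMiranda.

(** * Euclidean geometry and projections *)

Section Euclid.
Variables (R : realType) (d : nat).
Implicit Types (u v w x y z : 'rV[R]_d) (A B : set 'rV[R]_d).

Lemma dotpC u v : dotp u v = dotp v u.
Proof. by apply: eq_bigr => i _; rewrite mulrC. Qed.

Lemma dotpDl u v w : dotp (u + v) w = dotp u w + dotp v w.
Proof. by rewrite -big_split; apply: eq_bigr => i _; rewrite mxE mulrDl. Qed.

Lemma dotpZl a u w : dotp (a *: u) w = a * dotp u w.
Proof. by rewrite [RHS]mulr_sumr; apply: eq_bigr => i _; rewrite mxE mulrA. Qed.

Lemma dotpNl u w : dotp (- u) w = - dotp u w.
Proof. by rewrite -scaleN1r dotpZl mulN1r. Qed.

Lemma dotpBl u v w : dotp (u - v) w = dotp u w - dotp v w.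
Proof. by rewrite dotpDl dotpNl. Qed.

Lemma dotpDr u v w : dotp w (u + v) = dotp w u + dotp w v.
Proof. by rewrite dotpC dotpDl !(dotpC w). Qed.

Lemma dotpZr a u w : dotp w (a *: u) = a * dotp w u.
Proof. by rewrite dotpC dotpZl dotpC. Qed.

Lemma dotpNr u w : dotp w (- u) = - dotp w u.
Proof. by rewrite dotpC dotpNl dotpC. Qed.

Lemma dotpBr u v w : dotp w (u - v) = dotp w u - dotp w v.
Proof. by rewrite dotpDr dotpNr. Qed.

Lemma dotp_subZ u v a :
  dotp (u - a *: v) (u - a *: v) = dotp u u - 2 * a * dotp u v + a ^+ 2 * dotp v v.
Proof.
by rewrite !(dotpBl, dotpBr, dotpZl, dotpZr) (dotpC v u); ring.
Qed.

Lemma dotp_sumr (I : Type) (r : seq I) (F : I -> 'rV[R]_d) u :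
  dotp u (\sum_(i <- r) F i) = \sum_(i <- r) dotp u (F i).
Proof.
apply: (big_morph (dotp u)) => [v w|]; first exact: dotpDr.
by rewrite -(scale0r u) dotpZr mul0r.
Qed.

Lemma dotp_ge0 u : 0 <= dotp u u.
Proof. by apply: sumr_ge0 => i _; rewrite -expr2 sqr_ge0. Qed.

Lemma enorm_ge0 u : 0 <= enorm u.
Proof. exact: sqrtr_ge0. Qed.

Lemma enorm_sq u : enorm u ^+ 2 = dotp u u.
Proof. by rewrite sqr_sqrtr // dotp_ge0. Qed.

Lemma sqr_coord_le u i : u 0 i ^+ 2 <= dotp u u.
Proof.
rewrite /dotp (bigD1 i) //= -expr2 lerDl.
by apply: sumr_ge0 => j _; rewrite -expr2 sqr_ge0.
Qed.

Lemma dotp_eq0 u : dotp u u = 0 -> u = 0.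
Proof.
move=> u0; apply/rowP => i; rewrite mxE; apply/eqP.
by rewrite -sqrf_eq0 eq_le sqr_ge0 -u0 sqr_coord_le.
Qed.

Lemma coord_le_enorm u i : `|u 0 i| <= enorm u.
Proof. by rewrite -sqrtr_sqr ler_wsqrtr // sqr_coord_le. Qed.

Lemma enormN u : enorm (- u) = enorm u.
Proof. by rewrite /enorm dotpNl dotpNr opprK. Qed.

Lemma enormBC u v : enorm (u - v) = enorm (v - u).
Proof. by rewrite -enormN opprB. Qed.

(** Cauchy-Schwarz, from the square of the component of [u] orthogonal to [v]. *)
Lemma dotp_le_enorm u v : dotp u v <= enorm u * enorm v.
Proof.
have uv : dotp u v ^+ 2 <= dotp u u * dotp v v.
  have [v0|v0] := eqVneq (dotp v v) 0.
    by rewrite v0 (dotp_eq0 v0) -(scale0r u) dotpZr !mul0r mulr0 expr0n.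
  have vp : 0 < dotp v v by rewrite lt0r v0 dotp_ge0.
  have := dotp_ge0 (dotp v v *: u - dotp u v *: v).
  rewrite !(dotpBl, dotpBr, dotpZl, dotpZr) (dotpC v u) => h.
  rewrite -(ler_pM2l vp); nra.
apply: le_trans (ler_norm _) _.
by rewrite -sqrtr_sqr -sqrtrM ?dotp_ge0 // ler_wsqrtr.
Qed.

Lemma coord_sub_continuous y i : continuous (fun x => (x - y) 0 i).
Proof.
have -> : (fun x => (x - y) 0 i) = (fun x => x 0 i) \- cst (y 0 i).
  by apply/funext => x; rewrite !mxE.
move=> x; apply: continuousB; last exact: cst_continuous.
exact: coord_continuous.
Qed.

Lemma dotp_continuous (f g : 'rV[R]_d -> 'rV[R]_d) :
  (forall i, continuous (fun x => f x 0 i)) ->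
  (forall i, continuous (fun x => g x 0 i)) ->
  continuous (fun x => dotp (f x) (g x)).
Proof.
move=> cf cg; apply: continuous_big => [|i _ x]; first exact: add_continuous.
exact: (cvgM (cf i x) (cg i x)).
Qed.

Lemma enorm_dist_continuous y : continuous (fun x => enorm (y - x)).
Proof.
under eq_fun do rewrite enormBC.
move=> x; apply: (@continuous_comp _ _ _ (fun x => dotp (x - y) (x - y)) Num.sqrt).
  by apply: dotp_continuous => i; exact: coord_sub_continuous.
exact: sqrt_continuous.
Qed.

Lemma dist_pt_le y B b : B b -> dist_pt y B <= enorm (y - b).
Proof.
move=> Bb; apply: ge_inf; last by exists b.
by exists 0 => _ [c _ <-]; exact: enorm_ge0.
Qed.

Lemma dist_pt_attained y B : B !=set0 -> compact B ->
  exists2 q, B q & enorm (y - q) = dist_pt y B.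
Proof.
move=> B0 Bc.
have [|q qB qmin] := @compact_EVT_min _ R (fun x => enorm (y - x)) B B0 Bc.
  by apply: continuous_subspaceT; exact: enorm_dist_continuous.
rewrite inE in qB; exists q => //; apply/eqP; rewrite eq_le dist_pt_le // andbT.
apply: lb_le_inf; first by exists (enorm (y - q)), q.
by move=> _ [b Bb <-]; apply: qmin; rewrite inE.
Qed.

(** Moving from the nearest point [q] a fraction [t] of the way to [b] changes the
    squared distance by [- 2 t s + t^2 D], which would be negative for small [t]
    if [s] were positive. *)
Lemma projection_obtuse y B q b : convex_set B -> B q ->
  enorm (y - q) = dist_pt y B -> B b -> dotp (b - q) (y - q) <= 0.
Proof.
move=> Bconv Bq qd Bb; rewrite leNgt; apply/negP => s0.
set s := dotp _ _ in s0; set D := dotp (b - q) (b - q).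
have D0 : 0 <= D by exact: dotp_ge0.
have sD : 0 < s + D by lra.
(* This fraction lies in [0, 1] and keeps t * D below s. *)
have t01 : 0 <= s / (s + D) <= 1.
  apply/andP; split; first by apply: divr_ge0; exact: ltW.
  by rewrite ler_pdivrMr // mul1r lerDl.
set t := s / (s + D) in t01.
have tsD : t * (s + D) = s by rewrite divfK // gt_eqF.
have Bc : B (t *: b + (1 - t) *: q).
  have := Bconv b q (Itv01 (andP t01).1 (andP t01).2).
  by rewrite !inE; apply.
have := dist_pt_le y Bc; rewrite -qd.
rewrite -(ler_pXn2r (n := 2)) ?nnegrE ?enorm_ge0 // !enorm_sq.
have -> : y - (t *: b + (1 - t) *: q) = (y - q) - t *: (b - q).
  by apply/rowP => i; rewrite !mxE; ring.
rewrite dotp_subZ (dotpC (y - q)) -/s -/D.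
have t0 : 0 < t by rewrite divr_gt0.
nra.
Qed.

End Euclid.

(** * Set-valued maps *)

Section Multimap.
Variables (R : realType) (d : nat).
Implicit Types (u v w x y z : 'rV[R]_d) (A B : set 'rV[R]_d).

Lemma metric_projP y A : CC A ->
  A (metric_proj y A) /\ enorm (y - metric_proj y A) = dist_pt y A.
Proof.
case=> A0 Ac _; have [q Aq qd] := dist_pt_attained y A0 Ac.
by apply: (@xgetPex _ 0 [set p | A p /\ enorm (y - p) = dist_pt y A]); exists q.
Qed.

Lemma dist_pt_le_dist_set a A B : CC A -> B !=set0 -> A a ->
  dist_pt a B <= dist_set A B.
Proof.
move=> [A0 Ac _] [b Bb] Aa; apply: ub_le_sup; last by exists a.
have [|c cA cmax] := @compact_EVT_max _ R (fun x => enorm (b - x)) A A0 Ac.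
  by apply: continuous_subspaceT; exact: enorm_dist_continuous.
exists (enorm (b - c)) => _ [x Ax <-].
by apply: le_trans (dist_pt_le x Bb) _; rewrite enormBC; apply: cmax; rewrite inE.
Qed.

Variable F : 'rV[R]_d -> set 'rV[R]_d.
Hypothesis F_CC : forall x, CC (F x).
Hypothesis F_usc : upper_semicontinuous F.

(** The hyperplane separating [yb] from its projection onto [F x] leaves a gap of
    width [enorm w], which upper semicontinuity preserves near [x]. *)
Lemma local_separation x yb : ~ F x yb ->
  exists w, \forall x' \near x, forall y, F x' y -> 0 < dotp (y - yb) w.
Proof.
move=> nFx; have [Fx0 Fxc Fxconv] := F_CC x.
have [q Fq qd] := dist_pt_attained yb Fx0 Fxc.
pose w := q - yb; exists w.
have w0 : 0 < enorm w.
  rewrite lt0r enorm_ge0 andbT; apply/eqP => w0.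
  have /dotp_eq0 /subr0_eq qy : dotp w w = 0 by rewrite -enorm_sq w0 expr0n.
  by rewrite -qy in nFx.
have sep b : F x b -> enorm w ^+ 2 <= dotp (b - yb) w.
  move=> /(projection_obtuse Fxconv Fq qd).
  have -> : yb - q = - w by rewrite opprB.
  have -> : b - yb = (b - q) + w by rewrite addrA subrK.
  rewrite dotpNr [dotp (_ + w) _]dotpDl enorm_sq; lra.
have := F_usc x; move=> /cvgr_lt /(_ (enorm w) w0); apply: filterS => x' x'w y Fy.
have [b Fb yb'] := dist_pt_attained y Fx0 Fxc.
have lt_yb : enorm (b - y) < enorm w.
  by rewrite enormBC yb'; apply: le_lt_trans x'w; exact: dist_pt_le_dist_set.
have := sep b Fb; have := dotp_le_enorm (b - y) w.
have -> : b - yb = (b - y) + (y - yb) by rewrite addrA subrK.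
rewrite [dotp (_ + (y - yb)) w]dotpDl; nra.
Qed.

Lemma solutions_closed yb : closed (solutions F yb).
Proof.
rewrite -[solutions F yb]setCK; apply: open_closedC.
rewrite openE => x /local_separation[w]; apply: filterS => x' sep Fx'.
by have := sep _ Fx'; rewrite subrr -(scale0r w) dotpZl mul0r ltxx.
Qed.

(** Since [yb] belongs to [F xb], its distance to [F xt] is at most the Hausdorff
    distance of the two values.  For [L = 0] the left-hand side is [0],
    since [1 / 0 = 0]. *)
Lemma lipschitz_lower_bound (L : R) xt yb xb : 0 <= L -> set_lipschitz L F ->
  solutions F yb xb -> 1 / L * dist_pt yb (F xt) <= enorm (xb - xt).
Proof.
rewrite le_eqVlt => /orP[/eqP <- _ _|L0 FL Fxb].
  by rewrite invr0 mulr0 mul0r enorm_ge0.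
rewrite mul1r mulrC ler_pdivrMr // mulrC.
apply: le_trans (FL xb xt); rewrite le_max.
by rewrite dist_pt_le_dist_set //; case: (F_CC xt).
Qed.

(** Suppose that no point of the region [K] where the quadratic expression is
    nonnegative is a solution.  Near each point of [K] some fixed direction has positive inner
    product with all of [F _ - yb]; outside [K], the direction [xt - x] has
    positive inner product with the value of [F x - yb] that the relaxed
    one-sided Lipschitz condition selects.  Gluing these directions gives a
    continuous field [g] that has positive inner product with some vector at
    every point, hence no zero, although it points inwards on the boundary of a
    large cube. *)
Lemma exists_solution (l : R) xt yb p : l < 0 -> rosl l F -> F xt p ->
  exists2 x, F x yb & 0 <= l * dotp (x - xt) (x - xt) + dotp (p - yb) (x - xt).
Proof.
move=> l0 Frosl Fp.
pose al x := l * dotp (x - xt) (x - xt) + dotp (p - yb) (x - xt).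
pose K := [set x | 0 <= al x].
have al_cont : continuous al.
  have c1 : continuous (fun x => dotp (x - xt) (x - xt)).
    by apply: dotp_continuous => i; exact: coord_sub_continuous.
  have c2 : continuous (fun x => dotp (p - yb) (x - xt)).
    apply: (@dotp_continuous _ _ (fun=> p - yb)) => i.
      exact: cst_continuous.
    exact: coord_sub_continuous.
  by move=> x; exact: (cvgD (cvgM (cvg_cst l) (c1 x)) (c2 x)).
have below x : exists2 y, F x y & dotp (y - yb) (x - xt) <= al x.
  have [y Fy] := Frosl xt x p Fp; rewrite enorm_sq -(opprB x xt) => py; exists y => //.
  move: py; rewrite /al !dotpNr !dotpNl !(dotpBl _ _ (x - xt)); lra.
pose M := enorm (p - yb) / - l.
have M0 : 0 <= M by rewrite divr_ge0 ?enorm_ge0 // oppr_ge0 ltW.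
have KM x : K x -> cube xt M x.
  move=> Kx i; have -> : x 0 i - xt 0 i = (x - xt) 0 i by rewrite !mxE.
  apply: le_trans (coord_le_enorm _ _) _; rewrite /M ler_pdivlMr ?oppr_gt0 //.
  move: Kx; rewrite /K /= /al -enorm_sq.
  have := dotp_le_enorm (p - yb) (x - xt); have := enorm_ge0 (x - xt).
  have := enorm_ge0 (p - yb).
  by move=> ? ? ? ?; nra.
have Kcl : closed K.
  apply: (@preimage_closed _ _ al [set t | 0 <= t]); last exact: closed_ge.
  by move=> x _; exact: al_cont.
have Kc : compact K := subclosed_compact Kcl (@cube_compact _ _ xt M) KM.
apply: contrapT => nosol.
have {}nosol x : K x -> ~ F x yb by move=> Kx Fx; apply: nosol; exists x.
(* The radii are at most 1 so that the bumps [wt] below vanish on the boundary of the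
   cube of radius [M + 1]. *)
pose good x (we : 'rV[R]_d * R) := [/\ 0 < we.2, we.2 <= 1 &
  K x -> forall x', ball x we.2 x' -> forall y, F x' y -> 0 < dotp (y - yb) we.1].
have /choice[we weP] x : exists we, good x we.
  have [Kx|nKx] := pselect (K x); last by exists (0, 1); split.
  have [w /nbhs_ballP[e /= e0 we]] := local_separation (nosol x Kx).
  exists (w, Num.min e 1); split => /=; rewrite ?lt_min ?e0 ?ltr01 ?ge_min ?lexx ?orbT //.
  move=> _ x' xx'; apply: we; apply: le_ball xx'; by rewrite ge_min lexx.
pose w x := (we x).1; pose e x := (we x).2.
have [D DK Dcov] : exists2 D : seq 'rV[R]_d, {in D, forall c, K c} &
    forall x, K x -> exists2 c, c \in D & ball c (e c) x.
  have : finite_subset_cover K (fun x => ball x (e x)) K.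
    move: Kc; rewrite compact_cover; apply => [x _|x Kx]; first exact: ball_open.
    by exists x => //; apply: ballxx; case: (weP x).
  case=> D DK Dcov; exists (finmap.enum_fset D) => [c /DK/set_mem //|x /Dcov[c cD cx]].
  by exists c.
pose wt c x := Num.max 0 (e c - `|c - x|).
(* [b] is positive exactly outside [K], where the bumps may all vanish. *)
pose b x := Num.max 0 (- al x).
pose g x := \sum_(c <- D) wt c x *: w c - b x *: (x - xt).
have wt_ge0 c x : 0 <= wt c x by rewrite le_max lexx.
have wt_gt0 c x : (0 < wt c x) = (`|c - x| < e c) by rewrite lt_max ltxx subr_gt0.
have wt_ball c x : 0 < wt c x -> ball c (e c) x by rewrite wt_gt0 -ball_normE.
have b_ge0 x : 0 <= b x by rewrite le_max lexx.
have gE x i : g x 0 i = \sum_(c <- D) wt c x * w c 0 i - b x * (x 0 i - xt 0 i).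
  by rewrite !mxE summxE; congr (_ - _); apply: eq_bigr => c _; rewrite mxE.
have g_cont i : continuous (fun x => g x 0 i).
  have max0_cont (f : 'rV[R]_d -> R) : continuous f -> continuous (fun x => Num.max 0 (f x)).
    by move=> fc x; exact: (@continuous_max R _ (cst 0) f x (@cst_continuous _ _ _ x) (fc x)).
  have wt_cont c : continuous (wt c).
    apply: max0_cont => x.
    apply: (@continuousB _ _ _ (cst (e c)) (fun x => `|c - x|)); first exact: cst_continuous.
    apply: (@continuous_comp _ _ _ (fun x => c - x) Num.norm); last exact: norm_continuous.
    by apply: (@continuousB _ _ _ (cst c) id); [exact: cst_continuous | move=> ?].
  have b_cont : continuous b.
    by apply: max0_cont => x; exact: (cvgN (al_cont x)).
  have s_cont : continuous (fun x => \sum_(c <- D) wt c x * w c 0 i).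
    apply: continuous_big => [|c _ x]; first exact: add_continuous.
    exact: (cvgM (wt_cont c x) (cvg_cst _)).
  have -> : (fun x => g x 0 i) =
      fun x => \sum_(c <- D) wt c x * w c 0 i - b x * (x - xt) 0 i.
    by apply/funext => x; rewrite gE !mxE.
  move=> x; apply: (@continuousB _ _ _ _ (fun x => b x * (x - xt) 0 i)); first exact: s_cont.
  by apply: (@continuousM _ _ b); [exact: b_cont | exact: coord_sub_continuous].
have g_far x i : M + 1 <= `|x 0 i - xt 0 i| -> g x 0 i = - (b x * (x 0 i - xt 0 i)).
  move=> far; rewrite gE big_seq big1 ?sub0r // => c cD.
  suff : ~~ (0 < wt c x).
    by rewrite lt0r wt_ge0 andbT negbK => /eqP ->; rewrite mul0r.
  apply/negP => /wt_ball [_ /(_ 0 i)]; rewrite /ball /= => cx.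
  have /KM /(_ i) cM := DK c cD.
  have [_ e1 _] := weP c; rewrite -/(e c) in e1.
  have := ler_distD (c 0 i) (x 0 i) (xt 0 i); rewrite (distrC (x 0 i) (c 0 i)).
  lra.
have [||||x _ gx0] := @poincare_miranda R d g xt (M + 1); rewrite ?ltr_wpDl //.
- move=> x i _ xi; rewrite g_far xi addrAC subrr sub0r ?normrN ?ger0_norm ?addr_ge0 //.
  by rewrite mulrN opprK mulr_ge0 // addr_ge0.
- move=> x i _ xi; rewrite g_far xi addrAC subrr add0r ?ger0_norm ?addr_ge0 //.
  by rewrite oppr_le0 mulr_ge0 // addr_ge0.
have [y Fy ybelow] := below x.
have : dotp (y - yb) (g x) = 0 by rewrite gx0 -(scale0r 0) dotpZr mul0r.
rewrite dotpBr dotp_sumr dotpZr.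
under eq_bigr do rewrite dotpZr.
have term_ge0 c : c \in D -> 0 <= wt c x * dotp (y - yb) (w c).
  move=> cD; have := wt_ge0 c x; rewrite le_eqVlt => /orP[/eqP <-|wt0].
    by rewrite mul0r.
  apply: mulr_ge0 => //; apply: ltW; have [_ _ h] := weP c.
  by apply: h (wt_ball _ _ wt0) _ Fy; exact: DK.
have sum_ge0 : 0 <= \sum_(c <- D) wt c x * dotp (y - yb) (w c).
  by rewrite big_seq; exact: sumr_ge0.
have [alx|alx] := ltP (al x) 0.
  (* Here dotp (y - yb) (x - xt) <= al x < 0, so the term of [b] is at least al x ^ 2. *)
  have -> : b x = - al x by apply/max_idPr; rewrite oppr_ge0 ltW.
  by nra.
have [c cD cx] := Dcov x alx.
have -> : b x = 0 by apply/max_idPl; rewrite oppr_le0.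
rewrite mul0r subr0 => /eqP.
rewrite big_seq psumr_eq0 // => /allP /(_ c cD); rewrite cD /= => /eqP c0.
have wt0 : 0 < wt c x by rewrite wt_gt0; move: cx; rewrite -ball_normE.
have [_ _ h] := weP c; have := h (DK c cD) x cx y Fy; rewrite -/(w c) => dp.
by have := mulr_gt0 wt0 dp; rewrite c0 ltxx.
Qed.

End Multimap.

(** With [c = 1 / (2 l)], both sides of the inequality contain the term
    [c^2 <v, v>], and what is left is [l <z, z> - <v, z> >= 0] divided by [l]. *)
Lemma ball_of_quadratic (R : realType) (d : nat) (l : R) (z v : 'rV[R]_d) :
  l < 0 -> 0 <= l * dotp z z - dotp v z ->
  enorm (z - (1 / (2 * l)) *: v) <= - (1 / (2 * l)) * enorm v.
Proof.
move=> l0 lz.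
have c0 : 0 <= - (1 / (2 * l)).
  by rewrite oppr_ge0 mul1r invr_le0 pmulr_rle0 // ltW.
rewrite -(ler_pXn2r (n := 2)) ?nnegrE ?enorm_ge0 ?mulr_ge0 ?enorm_ge0 //.
rewrite exprMn !enorm_sq dotp_subZ (dotpC z v) sqrrN gerDr subr_le0.
have -> : 2 * (1 / (2 * l)) * dotp v z = dotp v z / l by field; rewrite lt_eqF.
rewrite ler_ndivlMr // mulrC; lra.
Qed.

Theorem theorem1 (R : realType) (d : nat) (F : 'rV[R]_d -> set 'rV[R]_d)
    (l : R) (xt yb : 'rV[R]_d)
    (F_CC : forall x : 'rV[R]_d, CC (F x))
    (F_usc : upper_semicontinuous F)
    (l_lt0 : l < 0)
    (F_rosl : rosl l F) :
  [/\ exists2 xb : 'rV[R]_d, solutions F yb xb &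
        enorm (xb - (xt + (1 / (2 * l)) *: (yb - metric_proj yb (F xt))))
          <= - (1 / (2 * l)) * dist_pt yb (F xt),
      closed (solutions F yb)
    & forall L : R, 0 <= L -> set_lipschitz L F ->
        forall xb : 'rV[R]_d, solutions F yb xb ->
          1 / L * dist_pt yb (F xt) <= enorm (xb - xt)].
Proof.
have [Fp pd] := metric_projP yb (F_CC xt); set p := metric_proj yb (F xt) in Fp pd *.
split; [|exact: solutions_closed | by move=> L L0 FL xb; exact: lipschitz_lower_bound].
have [xb Fxb xbK] := exists_solution F_CC F_usc yb l_lt0 F_rosl Fp.
exists xb => //; rewrite -pd opprD addrA; apply: ball_of_quadratic => //.
by move: xbK; rewrite -(opprB yb p) dotpNl.
Qed.
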